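(* For any integer $n\geq 3$ there exists a finite solvable group $G$ such that $\gamma_{\text{cp}}(G)=n$.
   Context: All groups are finite. For subsets $A_1,\dots,A_k$ of a group $G$, $A_1\cdots A_k=\{a_1\cdots a_k : a_i\in A_i\}$ is the setwise product. For a finite group $G$, $\gamma_{\text{cp}}(G)$ is defined as follows: if $G$ is non-nilpotent, $\gamma_{\text{cp}}(G)$ is the smallest integer $k$ such that there exist proper subgroups $A_1,\dots,A_k$ of $G$, any two of which are conjugate in $G$ (repetitions allowed), with $G=A_1\cdots A_k$; such a $k$ exists for non-nilpotent $G$. If $G$ is nilpotent, $\gamma_{\text{cp}}(G)=\infty$. *)

(* Defs.v *)
From mathcomp Require Import all_boot all_fingroup all_solvable.

Set Implicit Arguments.
Unset Strict Implicit.
Unset Printing Implicit Defensive.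

Local Open Scope group_scope.

Definition cp_factorization (gT : finGroupType) (G : {group gT}) (k : nat) : bool :=
  [exists A : {ffun 'I_k -> {group gT}},
    [&& [forall i, A i \proper G],
        [forall i, forall j, exists x in G, A j == A i :^ x :> {set gT}] &
        \prod_(i < k) (A i : {set gT}) == G]].

Lemma non_nilpotent_abnormal (gT : finGroupType) (G : {group gT}) :
  ~~ nilpotent G ->
  exists2 H : {group gT}, H \proper G & <<class_support H G>> = G.
Proof.
move=> nnilG.
have [P sylP nPG]: exists2 P : {group gT}, Sylow G P & ~~ (P <| G).
  apply/exists_inP; apply: contraR nnilG; rewrite negb_exists_in => /forall_inP nP.
  apply: nilpotentS (Fitting_nil G).
  rewrite -{1}(Sylow_gen G) gen_subG; apply/bigcupsP=> P sylP.
  have /SylowP[p _ pP] := sylP.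
  apply: Fitting_max (pgroup_nil (pHall_pgroup pP)).
  by have := nP P sylP; rewrite negbK.
have /SylowP[p _ pP] := sylP; have sPG := pHall_sub pP.
have sNG : 'N_G(P) \subset G by rewrite subsetIl.
exists ('N_G(P))%G.
  rewrite properE sNG /=; apply: contra nPG => sGN.
  by rewrite /normal sPG (subset_trans sGN) ?subsetIr.
set K := <<_>>; have nKG : K <| G.
  rewrite /normal gen_subG class_support_subG //=.
  by rewrite norms_gen ?class_support_norm.
have sNK : 'N_G(P) \subset K by rewrite sub_gen ?sub_class_support.
have sPK : P \subset K by rewrite (subset_trans _ sNK) // subsetI sPG normG.
have sylPK : p.-Sylow(K) P by apply: pHall_subl pP; rewrite ?(normal_sub nKG).
have := Frattini_arg nKG sylPK => defG.
by rewrite -[RHS]defG mulGSid.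
Qed.

Lemma cp_factorization_exists (gT : finGroupType) (G : {group gT}) :
  ~~ nilpotent G -> exists k, cp_factorization G k.
Proof.
move=> /non_nilpotent_abnormal[H prH genH].
have [m defG] := gen_expgs (class_support H G).
pose B x : {set gT} := H :^ x.
suff [s sG defs] : exists2 s : seq gT, {subset s <= G} & \prod_(x <- s) B x = G.
  exists (size s); apply/existsP; exists [ffun i : 'I_(size s) => (H :^ nth 1%g s i)%G].
  have sGi (i : 'I_(size s)) : nth 1%g s i \in G by rewrite sG ?mem_nth.
  apply/and3P; split.
  - by apply/forallP=> i; rewrite ffunE /= -(conjGid (sGi i)) properJ.
  - apply/forallP=> i; apply/forallP=> j; apply/exists_inP.
    exists ((nth 1%g s i)^-1 * nth 1%g s j); first by rewrite groupM ?groupV.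
    by rewrite !ffunE /= -conjsgM mulKVg.
  - by rewrite -[X in _ == X]defs (big_nth 1) big_mkord; apply/eqP/eq_bigr=> i _; rewrite ffunE.
pose t := enum G; pose S := \prod_(x <- t) B x.
have sub_prod (r : seq gT) : 1 \in \prod_(x <- r) B x
    /\ forall x, x \in r -> B x \subset \prod_(x <- r) B x.
  elim: r => [|y r [IH1 IHr]]; first by rewrite big_nil set11; split.
  rewrite big_cons; split; first by rewrite -[1]mulg1 mem_mulg // group1.
  move=> x /predU1P[-> | /IHr sx]; first by rewrite mulg_subl.
  by apply: subset_trans sx _; rewrite mulg_subr // group1.
have prodG (r : seq gT) : {subset r <= G} -> \prod_(x <- r) B x \subset G.
  move=> rG; rewrite big_seq; elim/big_ind: _ => [|X Y XG YG|x /rG xG].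
  - by rewrite sub1G.
  - exact: mul_subG.
  - by rewrite /B conj_subG ?(proper_sub prH).
exists (flatten (nseq m t)).
  by move=> x /flattenP[r /nseqP[-> _]]; rewrite mem_enum.
apply/eqP; rewrite eqEsubset prodG /=; last first.
  by move=> x /flattenP[r /nseqP[-> _]]; rewrite mem_enum.
have -> : \prod_(x <- flatten (nseq m t)) B x = S ^+ m.
  by elim: m {defG} => [|m IH]; rewrite ?big_nil ?expgS //= big_cat IH.
rewrite -{1}genH defG; elim: m {defG} => [|m IH]; first by rewrite !expg0.
rewrite !expgS mulgSS // subUset sub1set (sub_prod t).1.
rewrite class_supportEr; apply/bigcupsP=> x xG.
by apply: (sub_prod t).2; rewrite mem_enum.
Qed.

(* [None] stands for infinity. *)
Definition gamma_cp (gT : finGroupType) (G : {group gT}) : option nat :=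
  match boolP (nilpotent G) with
  | AltTrue _ => None
  | AltFalse nnilG => Some (ex_minn (cp_factorization_exists nnilG))
  end.

(* Main.v *)
Require Import Defs.
From mathcomp Require Import all_boot all_fingroup all_solvable.
From mathcomp Require Import zify.

Set Implicit Arguments.
Unset Strict Implicit.
Unset Printing Implicit Defensive.

(* Let p be an odd prime and G the dihedral group of order 2p. A subgroup of
   order p is normal, so in a factorization of G into k conjugates of a proper
   subgroup the factors have order at most 2, whence 2p <= 2^k. Conversely, let
   x be a rotation of order p and y a reflection; the conjugate of y by x^b is
   y x^(2b). If a product P of conjugates of <y> contains the cosets
   <y> x^(2i) for i < m, then multiplying P on the right by the conjugate of
   <y> by x^(2m-1) adds the cosets <y> x^(2(2m-1-i)), i.e. doubles m. Hence
   k+1 factors give all of G as soon as p <= 2^k, and gamma_cp(G) = n whenever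
   2^(n-2) < p <= 2^(n-1). Such a prime exists by Bertrand's postulate for
   powers of two, for which we follow Erdos: without a prime in ]N, 2N], the
   central binomial coefficient C(2N, N) has only prime factors p <= 2N/3, those
   above sqrt(2N) occur at most once, and every prime power p^e dividing it is
   at most 2N; with the bound 4^n on the product of the primes up to n this
   contradicts 4^N <= 2N C(2N, N) for large N. *)

(** * A prime between consecutive powers of two *)

Lemma bin_odd_mid m : (2 * m.+1) * 'C(m.*2.+1, m) = m.+1 * 'C(m.+1.*2, m.+1).
Proof. by rewrite mul2n -mul_bin_diag doubleS. Qed.

Lemma mul_bin_odd_mid m : m.+1 * 'C(m.*2.+1, m) = m.*2.+1 * 'C(m.*2, m).
Proof. rewrite mul_bin_down. congr (_ * _). lia. Qed.

Lemma central_bin_succ m : m.+1 * 'C(m.+1.*2, m.+1) = 2 * m.*2.+1 * 'C(m.*2, m).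
Proof. by rewrite -bin_odd_mid -!mulnA mul_bin_odd_mid. Qed.

(** The ratio of consecutive terms is (4m+6)/(m+2) < 4. *)
Lemma bin_odd_mid_le m : 'C(m.*2.+1, m) <= 4 ^ m.
Proof.
elim: m => // m IH; rewrite expnS.
have H1 := mul_bin_odd_mid m.+1; have H2 := bin_odd_mid m.
nia.
Qed.

Lemma central_bin_ge m : 0 < m -> 4 ^ m <= m.*2 * 'C(m.*2, m).
Proof.
case: m => // m _; elim: m => // m IH; rewrite expnS.
have H := central_bin_succ m.+1; nia.
Qed.

(** * The product of the primes up to n *)

Lemma dvdn_prime_fact p n : prime p -> (p %| n`!) = (p <= n).
Proof.
move=> pp; apply/idP/idP=> [|le_pn]; last by rewrite dvdn_fact // prime_gt0.
elim: n => [|n IH]; first by rewrite fact0 dvdn1 => /eqP p1; rewrite p1 in pp.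
by rewrite factS Euclid_dvdM // => /orP[/dvdn_leq-> // | /IH/leqW].
Qed.

Lemma prod_primes_dvd (r : seq nat) n :
  uniq r -> all prime r -> all (dvdn^~ n) r -> \prod_(p <- r) p %| n.
Proof.
elim: r => [|p r IH] /=; first by rewrite big_nil dvd1n.
move=> /andP[pr ur] /andP[pp ar] /andP[pn an]; rewrite big_cons Gauss_dvd ?pn ?IH //.
rewrite big_seq; elim/big_ind: _ => [|a b pa pb|q qr]; rewrite ?coprimen1 ?coprimeMr ?pa //.
rewrite prime_coprime // dvdn_prime2 // ?(allP ar q qr) //.
by apply: contraNneq pr => ->.
Qed.

(** Strong induction: an even n > 2 is not prime, and for n = 2m+1 the primes in ]m+1, 2m+1] all
    divide C(2m+1, m) <= 4^m. *)
Lemma primorial_le n : \prod_(0 <= p < n.+1 | prime p) p <= 4 ^ n.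
Proof.
elim/ltn_ind: n => n IH.
have [n_lt3|n_ge3] := ltnP n 3.
  by case: n n_lt3 {IH} => [|[|[|]]] // _; rewrite unlock.
have [odd_n|even_n] := boolP (odd n); last first.
  rewrite big_mkcond big_nat_recr //= -big_mkcond /=.
  have -> : prime n = false.
    by apply/negP => /even_prime[] En; move: n_ge3 even_n; rewrite ?En // => _ ->.
  rewrite muln1; have -> : n = n.-1.+1 by lia.
  apply: leq_trans (IH _ _) _; first by lia.
  by rewrite leq_exp2l //=; lia.
have [m En m_gt0]: exists2 m, n = m.*2.+1 & 0 < m by exists n./2; lia.
have := IH m.+1; rewrite En => /(_ ltac:(lia)) IHm.
rewrite (big_cat_nat _ (n := m.+2)) //=; last by lia.
have -> : 4 ^ m.*2.+1 = 4 ^ m.+1 * 4 ^ m by rewrite -expnD; congr (_ ^ _); lia.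
apply: leq_mul => //; apply: leq_trans (bin_odd_mid_le m).
apply: dvdn_leq; first by rewrite bin_gt0; lia.
rewrite -big_filter; apply: prod_primes_dvd.
- by rewrite filter_uniq // iota_uniq.
- exact: filter_all.
apply/allP => p; rewrite mem_filter mem_index_iota => /and3P[pp lo hi].
have: p %| (m.*2.+1)`! by rewrite dvdn_prime_fact.
rewrite -(@bin_fact m.*2.+1 m); last by lia.
rewrite !Euclid_dvdM // !dvdn_prime_fact; lia.
Qed.

(** * Prime powers dividing the central binomial coefficient *)

Lemma prod_logn n b : 0 < n -> (forall p, prime p -> p %| n -> p < b) ->
  n = \prod_(0 <= p < b) p ^ logn p n.
Proof.
move=> n_gt0 nb; set M := maxn n b.
rewrite -[LHS](partnT n_gt0) (widen_partn _ (leq_maxl n b)) -/M /=.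
rewrite (big_cat_nat _ (n := b)) //=; last by rewrite ltnW // ltnS leq_maxr.
rewrite [X in _ * X]big1_seq ?muln1 //.
move=> p; rewrite mem_index_iota => /and3P[_ bp _].
rewrite lognE; case: and3P => // -[pp _ /(nb p pp)]; lia.
Qed.

(** Legendre's formula for (2n)! and, twice, for n!, whose sum is extended by zero terms up to
    2n. *)
Lemma logn_central_bin p n : prime p ->
  logn p 'C(n.*2, n) = \sum_(1 <= i < n.*2.+1) (n.*2 %/ p ^ i - (n %/ p ^ i).*2).
Proof.
move=> pp; rewrite sumnB; last first.
  by move=> i _; rewrite -!muln2 leq_divRL ?expn_gt0 ?prime_gt0 // mulnAC leq_mul2r leq_divM.
rewrite -logn_fact //.
have := @bin_fact n.*2 n ltac:(lia); rewrite (_ : n.*2 - n = n); last by lia.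
move <-; have Cn : 0 < 'C(n.*2, n) by rewrite bin_gt0; lia.
rewrite !lognM ?muln_gt0 ?fact_gt0 //.
have -> : \sum_(1 <= i < n.*2.+1) (n %/ p ^ i).*2 = (logn p n`!).*2.
  rewrite logn_fact // -[RHS]muln2 big_distrl /=.
  rewrite [LHS](big_cat_nat _ (n := n.+1)) //=; last by lia.
  rewrite [X in _ + X]big1_seq ?addn0; last first.
    move=> i; rewrite mem_index_iota => /and3P[_ ni _].
    rewrite divn_small // (leq_trans _ (ltnW (ltn_expl i (prime_gt1 pp)))) //; lia.
  by apply: eq_bigr => i _; rewrite muln2.
by rewrite addnn addnK.
Qed.

Lemma leq_expn_logn_central_bin p n : prime p -> 0 < n ->
  p ^ logn p 'C(n.*2, n) <= n.*2.
Proof.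
move=> pp n_gt0; have p_gt1 := prime_gt1 pp.
have n2_gt0 : 0 < n.*2 by lia.
apply: leq_trans (trunc_logP p_gt1 n2_gt0); rewrite leq_exp2l //.
set t := trunc_log p n.*2; rewrite logn_central_bin //.
have lt_t2n : t < n.*2.+1.
  by apply/leqW/(leq_trans (ltn_expl t p_gt1))/trunc_logP.
rewrite (big_cat_nat _ (n := t.+1)) //=.
rewrite [X in _ + X]big1_seq ?addn0; last first.
  move=> i; rewrite mem_index_iota => /and3P[_ ti _].
  by rewrite divn_small // (leq_trans (trunc_log_ltn _ p_gt1)) // leq_exp2l.
(* Each term floor(2n/q) - 2 floor(n/q) is 0 or 1. *)
apply: (@leq_trans (\sum_(1 <= i < t.+1) 1)); last by rewrite sum_nat_const_nat; lia.
apply: leq_sum => i _; set q := p ^ i.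
have q_gt0 : 0 < q by rewrite expn_gt0 ltnW.
have := divn_eq n q; have := ltn_pmod n q_gt0; have := divn_eq n.*2 q.
set a := n %/ q; set b := n.*2 %/ q; set c := n %% q; nia.
Qed.

Lemma logn_central_bin_le1 p n : prime p -> 0 < n -> n.*2 < p ^ 2 ->
  logn p 'C(n.*2, n) <= 1.
Proof.
move=> pp n_gt0 lt_np2; rewrite -ltnS -(ltn_exp2l _ _ (prime_gt1 pp)).
exact: leq_ltn_trans (leq_expn_logn_central_bin pp n_gt0) lt_np2.
Qed.

Lemma logn_central_bin_eq0 p n : prime p -> p <= n -> n.*2 < 3 * p ->
  n.*2 < p ^ 2 -> logn p 'C(n.*2, n) = 0.
Proof.
move=> pp le_pn lt_n3p lt_np2; have p_gt1 := prime_gt1 pp.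
rewrite logn_central_bin // big1_seq // => i.
rewrite mem_index_iota => /and3P[_]; rewrite leq_eqVlt => /predU1P[<- _|i_gt1 _].
  (* Here floor(2n/p) = 2 and floor(n/p) = 1, so the term cancels. *)
  have lt3 : n.*2 %/ p < 3 by rewrite ltn_divLR // ltnW.
  have gt0 : 0 < n %/ p by rewrite divn_gt0 // ltnW.
  rewrite expn1; lia.
by rewrite divn_small // (leq_trans lt_np2) // leq_exp2l.
Qed.

Lemma central_bin_le n s :
    0 < n -> s <= n.*2 < s.+1 ^ 2 -> (forall p, prime p -> n < p -> n.*2 < p) ->
  'C(n.*2, n) <= n.*2 ^ s.+1 * 4 ^ (n.*2 %/ 3).
Proof.
move=> n_gt0 /andP[le_sn lt_ns2] no_prime.
have C_gt0 : 0 < 'C(n.*2, n) by rewrite bin_gt0; lia.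
have dvdC p : prime p -> p %| 'C(n.*2, n) -> p <= n.*2.
  move=> pp pC; rewrite -dvdn_prime_fact //.
  by rewrite -(@bin_fact n.*2 n) ?dvdn_mulr //; lia.
rewrite [X in X <= _](prod_logn C_gt0 (b := n.*2.+1)) //.
(* [small] charges 2n to every index from 0 to s, prime or not, hence the exponent s+1; [medium]
   charges p once to each prime p <= 2n/3. *)
pose small p := if p < s.+1 then n.*2 else 1.
pose medium p := if prime p && (p < (n.*2 %/ 3).+1) then p else 1.
apply: (@leq_trans (\prod_(0 <= p < n.*2.+1) (small p * medium p))).
  apply: leq_prod => p _; rewrite /small /medium.
  have [pp|npp] := boolP (prime p); last first.
    by rewrite lognE (negbTE npp) muln1 /=; case: ifP; lia.
  have p_gt0 := prime_gt0 pp.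
  have [lt_ps|le_sp] /= := ltnP p s.+1.
    apply: leq_trans (leq_expn_logn_central_bin pp n_gt0) _.
    by rewrite leq_pmulr //; case: ifP.
  have lt_np2 : n.*2 < p ^ 2 by rewrite (leq_trans lt_ns2) // leq_exp2r.
  rewrite mul1n; case: ltnP => [_|lt_3p].
    by rewrite -[leqRHS]expn1 leq_exp2l ?prime_gt1 ?logn_central_bin_le1.
  have [le_pn|lt_np] := leqP p n.
    by rewrite logn_central_bin_eq0 //; lia.
  rewrite lognE; case: and3P => // -[_ _ /(dvdC p pp)].
  by rewrite leqNgt no_prime.
rewrite big_split /=; apply: leq_mul.
  rewrite -[s.+1 in leqRHS]subn0 -prod_nat_const_nat.
  by rewrite [leqRHS](big_nat_widen _ _ n.*2.+1) //= [leqRHS]big_mkcond.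
apply: leq_trans (primorial_le (n.*2 %/ 3)).
by rewrite [leqRHS](big_nat_widen _ _ n.*2.+1) ?ltnS ?leq_div // [leqRHS]big_mkcond.
Qed.

Lemma exists_prime_pow2 k : 0 < k -> exists2 p, prime p & 2 ^ k < p <= 2 ^ k.+1.
Proof.
(* At k = 10 the final estimate is not yet contradictory, so explicit primes cover k <= 10. *)
move=> k_gt0; have [k_small|k_large] := ltnP k 11.
  pose ps := [:: 3; 5; 11; 17; 37; 67; 131; 257; 521; 1031].
  exists (nth 0 ps k.-1).
    have: all prime ps by vm_compute.
    by move/all_nthP; apply; rewrite /=; lia.
  have: all (fun k => 2 ^ k < nth 0 ps k.-1 <= 2 ^ k.+1) (iota 1 10) by vm_compute.
  by move/allP; apply; rewrite mem_iota; lia.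
have [/hasP[p]|/hasPn no_prime] := boolP (has prime (iota (2 ^ k).+1 (2 ^ k))).
  rewrite mem_iota => p_range pp; exists p => //; rewrite expnS; lia.
set n := 2 ^ k in no_prime; have n_gt0 : 0 < n by rewrite expn_gt0.
have n2E : n.*2 = 2 ^ k.+1 by rewrite expnS mul2n.
have no_prime' p : prime p -> n < p -> n.*2 < p.
  move=> pp lt_np; rewrite ltnNge; apply/negP => le_p2n.
  by have := no_prime p; rewrite mem_iota pp => /(_ ltac:(lia)).
(* A power of two at least sqrt(2n), so that every bound becomes a comparison of exponents of 2. *)
pose s := 2 ^ (k./2).+1.
have lt_ns2 : s <= n.*2 < s.+1 ^ 2.
  apply/andP; split; first by rewrite n2E leq_exp2l //; lia.
  apply: (@leq_ltn_trans (s ^ 2)); last by rewrite ltn_exp2r.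
  by rewrite n2E -expnM leq_exp2l //; lia.
have := leq_trans (central_bin_ge n_gt0)
  (leq_mul (leqnn n.*2) (central_bin_le n_gt0 lt_ns2 no_prime')).
have E4 m : 4 ^ m = 2 ^ m.*2 by rewrite -mul2n expnM.
have Epow : n.*2 ^ s.+2 = 2 ^ (k.+1 * s.+2) by rewrite n2E expnM.
rewrite !E4 mulnA -expnS Epow -expnD leq_exp2l // => le_exp.
have {le_exp} le_n : n.*2 <= 3 * (k.+1 * s.+2) by lia.
(* With t = 2^j, the inequality to refute amounts to t^2 <= (6j+3)(t+1) if k = 2j and to t^2 <=
   (3j+3)(t+1) if k = 2j+1. These two bounds make the factor in j at most t-6, and (t-6)(t+1) <
   t^2. *)
have even_bound j : 5 < j -> 6 * j + 9 <= 2 ^ j.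
  elim: j => // j IH; rewrite leq_eqVlt => /predU1P[<-|/IH]; first by [].
  rewrite expnS; lia.
have odd_bound j : 4 < j -> 3 * j + 9 <= 2 ^ j.
  elim: j => // j IH; rewrite leq_eqVlt => /predU1P[<-|/IH]; first by [].
  rewrite expnS; lia.
move: le_n; rewrite n2E /s; set j := k./2 => le_n.
have [odd_k|even_k] := boolP (odd k).
  have Ek : k = j + j + 1 by lia.
  have E2k : 2 ^ k.+1 = 4 * (2 ^ j * 2 ^ j) by rewrite Ek addn1 !expnS expnD; lia.
  have := odd_bound j ltac:(lia); move: le_n; rewrite E2k expnS; nia.
have Ek : k = j + j by lia.
have E2k : 2 ^ k.+1 = 2 * (2 ^ j * 2 ^ j) by rewrite Ek expnS expnD.
have := even_bound j ltac:(lia); move: le_n; rewrite E2k expnS; nia.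
Qed.

(** * Conjugate factorizations of dihedral groups *)

Local Open Scope group_scope.

Lemma gamma_cp_eq (gT : finGroupType) (G : {group gT}) n :
    ~~ nilpotent G -> cp_factorization G n ->
    (forall k, cp_factorization G k -> n <= k) ->
  gamma_cp G = Some n.
Proof.
move=> nnilG Gn n_min; rewrite /gamma_cp.
case: {-}_ / boolP => [nilG|nnil]; first by rewrite nilG in nnilG.
by case: ex_minnP => m Gm m_min; congr Some; apply/eqP; rewrite eqn_leq m_min // n_min.
Qed.

Lemma card_prod_le (gT : finGroupType) (I : Type) (r : seq I) (A : I -> {set gT}) c :
  (forall i, #|A i| <= c) -> #|\prod_(i <- r) A i| <= c ^ size r.
Proof.
move=> le_Ac; elim: r => [|i r IH]; first by rewrite big_nil cards1.
rewrite big_cons expnS (leq_trans _ (leq_mul (le_Ac i) IH)) //.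
by rewrite -cardsX /mulg /= /set_mulg curry_imset2X; apply: leq_imset_card.
Qed.

(** Applied with a the order and b the index of a proper subgroup of a group of order 2p. *)
Lemma double_prime_divisor p a b :
  prime p -> (a * b = 2 * p)%N -> 2 < a -> a < 2 * p -> b = 2.
Proof.
move=> pp def_ab lt2a lta2p; have p_gt0 := prime_gt0 pp.
have: p %| a * b by rewrite def_ab dvdn_mull.
rewrite Euclid_dvdM // => /orP[] /dvdnP[c def_c]; subst.
  have {}lta2p : c < 2 by rewrite -(ltn_pmul2r p_gt0).
  have {}def_ab : (c * b = 2)%N by apply/eqP; rewrite -(eqn_pmul2r p_gt0) mulnAC def_ab.
  by case: c lta2p lt2a def_ab => [|[|]] // _ _; rewrite mul1n.
have {}def_ab : (a * c = 2)%N by apply/eqP; rewrite -(eqn_pmul2r p_gt0) -mulnA def_ab.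
by case: c def_ab lt2a => [|c] <-; rewrite ?muln0 // ltnNge leq_pmulr.
Qed.

(** * Lower bound on the number of factors *)

Lemma cp_factorization_card (gT : finGroupType) (G : {group gT}) p k :
  prime p -> #|G| = p.*2 -> cp_factorization G k -> p.*2 <= 2 ^ k.
Proof.
move=> pp oG /existsP[A /and3P[/forallP prA /forallP conjA /eqP defG]].
have le_A i : #|A i| <= 2.
  rewrite leqNgt; apply/negP=> lt2A.
  have iG : #|G : A i| = 2.
    have := prA i; rewrite properEcard => /andP[sAG].
    have := Lagrange sAG; rewrite oG -mul2n => defp ltA.
    exact: double_prime_divisor pp defp lt2A ltA.
  have nAG : A i <| G by rewrite index2_normal ?proper_sub.
  (* All conjugates of a normal subgroup coincide with it, so the whole product would stay inside
     the proper subgroup [A i]. *)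
  have eqA j : A j \subset A i.
    have /forallP/(_ j)/exists_inP[x Gx /eqP->] := conjA i.
    by rewrite (normP (subsetP (normal_norm nAG) x Gx)).
  have /properP[_ [x Gx]] := prA i; apply/negP; rewrite negbK.
  move: Gx; rewrite -defG; apply/subsetP.
  elim/big_ind: _ => [|B C sB sC|j _]; rewrite ?sub1G ?mul_subG //.
have := card_prod_le (index_enum 'I_k) le_A.
by rewrite defG oG -[index_enum _]enumT size_enum_ord.
Qed.

(** * Construction of a short factorization *)

Lemma invert_mul_expg (gT : finGroupType) (x y : gT) i :
  x ^ y = x^-1 -> y * x ^+ i = x ^- i * y.
Proof. by move=> xy; rewrite [RHS]conjgC conjVg conjXg xy expVgn invgK. Qed.

Lemma invert_conj_expg (gT : finGroupType) (x y : gT) b :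
  x ^ y = x^-1 -> y ^ (x ^+ b) = y * x ^+ b.*2.
Proof. by move=> xy; rewrite conjgE mulgA -(invert_mul_expg _ xy) -mulgA -expgD addnn. Qed.

Lemma rcosets_sub_prod_conj (gT : finGroupType) (x y : gT) k i :
    x ^ y = x^-1 -> i < 2 ^ k ->
  <[y]> :* x ^+ i.*2 \subset \prod_(j < k.+1) (<[y]> :^ (x ^+ (2 ^ j).-1)).
Proof.
move=> xy; elim: k i => [|k IH] i.
  by rewrite expn0 ltnS leqn0 => /eqP->; rewrite big_ord1 expg0 conjsg1 rcoset1.
move=> lt_i; rewrite big_ord_recr /=.
have [lt_ik|le_ki] := ltnP i (2 ^ k).
  by apply: subset_trans (IH i lt_ik) _; rewrite mulg_subl // group1.
(* The new reflection y x^(2b) sends x^(2i') to y x^(2(b-i')), so i is reached from its mirror image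
   i' = b - i, which lies in the range already covered. *)
set b := (2 ^ k.+1).-1; pose i' := (b - i)%N.
have lt_i' : i' < 2 ^ k by rewrite /i' /b; move: lt_i; rewrite expnS; lia.
have Eb : (i'.*2 + i.*2 = b.*2)%N by rewrite /i' /b; lia.
apply: subset_trans (mulSg _ (IH i' lt_i')).
have -> : <[y]> :* x ^+ i.*2 = (<[y]> :* x ^+ i'.*2) :* (y ^ (x ^+ b)).
  rewrite -rcosetM (invert_conj_expg _ xy) -Eb expgD (mulgA y) (invert_mul_expg _ xy) -mulgA mulKVg.
  by rewrite rcosetM (rcoset_id (cycle_id y)).
by rewrite mulgS // sub1set memJ_conjg cycle_id.
Qed.

Lemma dihedral_cp_factorization (gT : finGroupType) (G : {group gT}) (x y : gT) p k :
    1 < p -> odd p -> <[x]> <*> <[y]> = G -> x ^+ p = 1 -> x ^ y = x^-1 ->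
    <[y]> \proper G -> p <= 2 ^ k ->
  cp_factorization G k.+1.
Proof.
move=> p_gt1 odd_p defG xp xy prY le_p.
have [Gx Gy] : x \in G /\ y \in G.
  by rewrite -defG; split; rewrite mem_gen // inE cycle_id ?orbT.
have GJ i : x ^+ i \in G by rewrite groupX.
apply/existsP; exists [ffun j : 'I_k.+1 => (<[y]> :^ (x ^+ (2 ^ j).-1))%G].
apply/and3P; split.
- by apply/forallP=> j; rewrite ffunE /= -(conjGid (GJ (2 ^ j).-1)) properJ.
- apply/forallP=> i; apply/forallP=> j; apply/exists_inP.
  exists ((x ^+ (2 ^ i).-1)^-1 * x ^+ (2 ^ j).-1); first by rewrite groupM ?groupV.
  by rewrite !ffunE /= -conjsgM mulKVg.
under eq_bigr do rewrite ffunE /=.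
rewrite eqEsubset; apply/andP; split.
  elim/big_ind: _ => [|B C sB sC|j _]; rewrite ?sub1G ?mul_subG //.
  by rewrite conj_subG // cycle_subG.
have nXY : <[y]> \subset 'N(<[x]>).
  by rewrite cycle_subG; apply/normP; rewrite -cycleJ xy cycleV.
rewrite -{1}defG norm_joinEr // -(normC nXY).
apply/subsetP=> _ /mulsgP[a _ Ya /cycleP[j ->] ->].
(* As p is odd, [uphalf p] is the inverse of 2 modulo p, so 2i = j modulo p. *)
pose i := (j * uphalf p %% p)%N.
have -> : x ^+ j = x ^+ i.*2.
  rewrite -(expg_mod _ xp) -[RHS](expg_mod _ xp) /i -muln2 modnMml -mulnA muln2.
  have -> : (uphalf p).*2 = p.+1 by lia.
  by rewrite mulnS addnC modnMDl.
have lt_i : i < 2 ^ k by rewrite (leq_trans _ le_p) // ltn_mod ltnW.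
by apply: (subsetP (rcosets_sub_prod_conj xy lt_i)); rewrite mem_rcoset mulgK.
Qed.

Theorem theorem4 (n : nat) (hn : 3 <= n) :
  exists (gT : finGroupType) (G : {group gT}),
    solvable G /\ gamma_cp G = Some n.
Proof.
have [p pp /andP[lt_p le_p]] := @exists_prime_pow2 (n - 2) ltac:(lia).
have p_gt2 : 2 < p.
  by apply: leq_ltn_trans lt_p; rewrite -[2%N]expn1 leq_exp2l //; lia.
have odd_p : odd p by case: (even_prime pp) p_gt2 => // ->.
have p_gt1 := ltnW p_gt2.
pose G := [set: 'D_p.*2]%G; have oG : #|G| = p.*2 by apply: card_dihedral.
exists _, G.
(* The presentation of the dihedral group yields the generators x and y with their relations. *)
have := homg_refl G; rewrite Grp_dihedral // => /existsP[[x y] /=].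
rewrite !xpair_eqE => /and4P[/eqP defG /eqP xp /eqP y2 /eqP xy].
have dvd_x : #[x] %| p by rewrite order_dvdn xp.
have dvd_y : #[y] %| 2 by rewrite order_dvdn y2.
have prY : <[y]> \proper G.
  by rewrite properEcard subsetT oG /= (leq_ltn_trans (dvdn_leq _ dvd_y)) //; lia.
have nXY : <[y]> \subset 'N(<[x]>).
  by rewrite cycle_subG; apply/normP; rewrite -cycleJ xy cycleV.
split.
  apply: metacyclic_sol; apply/metacyclicP; exists <[x]>%G; split.
  - exact: cycle_cyclic.
  - by rewrite /= -defG normalYl.
  - by rewrite /= -defG quotientYidl // quotient_cyclic ?cycle_cyclic.
have G_fact : cp_factorization G n.
  have -> : n = (n - 2).+2 by lia.
  exact: dihedral_cp_factorization p_gt1 odd_p defG xp xy prY le_p.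
apply: gamma_cp_eq => // [|k /(cp_factorization_card pp oG) le_pk]; last first.
  rewrite leqNgt; apply/negP => lt_kn; move: le_pk; apply/negP; rewrite -ltnNge.
  apply: (@leq_ltn_trans (2 * 2 ^ (n - 2))); last by rewrite -mul2n ltn_pmul2l.
  by rewrite -expnS leq_exp2l //; lia.
(* In a nilpotent group, x and y of coprime orders would commute. Then x = x^-1 has odd order, so x
   = 1 and G = <[y]>, which is proper. *)
apply/negP => nilG; have := prY; rewrite properE => /andP[_ /negP[]].
have co_xy : coprime #|<[x]>| #|<[y]>|.
  by apply: coprime_dvdl dvd_x _; apply: coprime_dvdr dvd_y _; rewrite coprimen2.
have cXY := sub_nilpotent_cent2 nilG (subsetT <[x]>) (subsetT <[y]>) co_xy.
have x_xV : x = x^-1.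
  by rewrite -xy conjgE -(centP (subsetP cXY y (cycle_id y)) x (cycle_id x)) mulKg.
have dvd_x2 : #[x] %| 2 by rewrite order_dvdn expgS expg1 [X in _ * X]x_xV mulgV.
have /eqP : coprime p 2 by rewrite coprimen2.
move/(congr1 (fun m => #[x] %| m)); rewrite dvdn_gcd dvd_x dvd_x2 dvdn1 => /esym.
by rewrite order_eq1 => /eqP x1; rewrite /= -defG x1 cycle1 joing1G.
Qed.
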